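(* There is a universal constant $K>0$ such that the following holds. Let $0<s<\infty$, $d\in\mathbb{N}$, $1<c<\infty$ and $0<q<1$, and assume $d/\ln(2/q)\ge 2$. Then there exists $\tau$ with $0<\tau<1$ (depending on $s,d,c,q$) such that for every $p$ and every $(\tau d,\ c\tau d,\ p,\ q)$-sensitive hash family $\mathcal{H}$ for the distance space $\ell_s^d$, $$\rho(\mathcal{H})=\frac{\ln(1/p)}{\ln(1/q)}\ \ge\ \frac1{c^s}-\left(K\cdot\frac{\ln(2/q)}{d}\cdot\ln\!\left(\frac{d}{\ln(2/q)}\right)\right)^{1/3}.$$
   Context: A distance space $(X,\mathrm{dist})$ is a metric space in which the triangle inequality need not hold. Let $U$ be any finite or countably infinite set, $r>0$ and $c>1$. A hash family for $X$ is a probability distribution $\mathcal{H}$ over functions $h:X\to U$. It is $(r,cr,p,q)$-sensitive, where $q<p$, if for all $x,y\in X$: (i) $\mathrm{dist}(x,y)\le r$ implies $\Pr_{h\sim\mathcal{H}}[h(x)=h(y)]\ge p$; and (ii) $\mathrm{dist}(x,y)\ge cr$ implies $\Pr_{h\sim\mathcal{H}}[h(x)=h(y)]\le q$. The rho parameter of an $(r,cr,p,q)$-sensitive family is $\rho(\mathcal{H})=\ln(1/p)/\ln(1/q)$. The distance space $\ell_s^d$ is $\mathbb{R}^d$ with distance $\|x-y\|_s=\left(\sum_{i=1}^d|x_i-y_i|^s\right)^{1/s}$. *)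

(* Defs.v *)
From HB Require Import structures.
From mathcomp Require Import all_boot all_order all_algebra.
From mathcomp Require Import all_classical all_reals all_analysis.

Set Implicit Arguments.
Unset Strict Implicit.
Unset Printing Implicit Defensive.
Import Order.TTheory GRing.Theory Num.Theory.
Import numFieldNormedType.Exports.

Local Open Scope classical_set_scope.
Local Open Scope ring_scope.

(* A metric, except that the triangle inequality is not required. *)
Definition is_distance (R : realType) (X : Type) (dist : X -> X -> R) : Prop :=
  [/\ forall x y, 0 <= dist x y,
      forall x y, dist x y = 0 <-> x = y
    & forall x y, dist x y = dist y x].

Definition collision (X U : Type) (x y : X) : set (X -> U) :=
  [set h | h x = h y].
Arguments collision : clear implicits.
Arguments collision {X} U x y.

Definition collisions (X U : Type) : set (set (X -> U)) :=
  [set A | exists x y : X, A = collision U x y].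

(* A probability distribution over functions X -> U. The sigma-algebra is the
   coarsest one giving every collision event a probability: a distribution on
   any sigma-algebra containing these events restricts to a [hash_family]
   without changing their probabilities. For countable U, one of these is the
   product sigma-algebra, generated by the evaluations.
   [pointedType] only asks U to be inhabited, as it must be for functions from
   a nonempty X to exist. *)
Definition hash_family (R : realType) (X : Type) (U : pointedType) : Type :=
  probability (g_sigma_algebraType (@collisions X U)) R.

(* [r'] stands for the far threshold c * r. *)
Definition sensitive (R : realType) (X : Type) (U : pointedType)
    (dist : X -> X -> R) (r r' p q : R) (H : hash_family R X U) : Prop :=
  q < p /\
  forall x y : X,
    (dist x y <= r -> (p%:E <= H (collision U x y))%E) /\
    (r' <= dist x y -> (H (collision U x y) <= q%:E)%E).

Definition rho (R : realType) (p q : R) : R := ln (1 / p) / ln (1 / q).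

Definition ell_dist (R : realType) (s : R) (d : nat) (x y : 'rV[R]_d) : R :=
  (\sum_(i < d) `|x 0 i - y 0 i| `^ s) `^ (1 / s).

Lemma ell_dist_is_distance (R : realType) (s : R) (d : nat) :
  0 < s -> is_distance (@ell_dist R s d).
Proof.
move=> s0; have s1 : 1 / s != 0 by rewrite div1r invr_eq0 gt_eqF.
split=> [x y|x y|x y]; first exact: powR_ge0.
- split=> [/eqP|->]; last first.
    rewrite /ell_dist big1 ?powR0// => i _.
    by rewrite subrr normr0 powR0// gt_eqF.
  rewrite /ell_dist powR_eq0 s1 andbT psumr_eq0 => [/allP xy|i _];
    last exact: powR_ge0.
  apply/rowP => i; move: (xy i (mem_index_enum i)).
  by rewrite powR_eq0 (gt_eqF s0) andbT normr_eq0 subr_eq0 => /eqP.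
- by rewrite /ell_dist; under eq_bigr do rewrite distrC.
Qed.

(* Main.v *)
Require Import Defs.
From HB Require Import structures.
From mathcomp Require Import all_boot all_order all_algebra.
From mathcomp Require Import all_classical all_reals all_analysis.
From mathcomp Require Import ring lra zify.

Set Implicit Arguments.
Unset Strict Implicit.
Unset Printing Implicit Defensive.
Import Order.TTheory GRing.Theory Num.Theory.
Import numFieldNormedType.Exports.

Local Open Scope classical_set_scope.
Local Open Scope ring_scope.

(* Map the cube {0,1}^d into l_s^d by a homothety, scaled so that the threshold
   [tau * d] becomes Hamming distance 2j; then [c * tau * d] becomes [c ^ s * 2j].
   Averaging the collision probability of z and z + t over z gives a
   positive definite function g on (Z/2)^d, so by Cauchy-Schwarz the expectation
   b n of g after 2n steps of the simple random walk from 0 is log-convex in n,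
   and b 0 = 1 yields (b j) ^ k <= (b k) ^ j for j <= k. After 2j steps the walk
   is within distance 2j, so p <= b j. Choose 2k a small multiple of d and a
   little larger than [c ^ s * 2j]: the walk rarely undoes its own steps, so after
   2k of them it is beyond [c ^ s * 2j] except with probability delta much smaller
   than q, and b k <= q + (1 - q) delta. Hence rho is nearly at least
   j / k, that is, nearly c ^ -s. *)

(** * The simple random walk on the cube *)

Local Notation cube d := {ffun 'I_d -> bool}.

(** Addition on [bool] is exclusive or, so adding [dir i] flips coordinate i. *)
Definition dir d (i : 'I_d) : cube d := [ffun j => j == i].

Definition wt d (x : cube d) : nat := \sum_(i < d) x i.

Lemma cube_addxx d (x : cube d) : x + x = 0.
Proof. by apply/ffunP => i; rewrite !ffunE; case: (x i). Qed.

Lemma cube_addK d (x y : cube d) : x + y + y = x.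
Proof. by rewrite -addrA cube_addxx addr0. Qed.

Lemma wt0 d : wt (0 : cube d) = 0%N.
Proof. by rewrite /wt big1// => i _; rewrite ffunE. Qed.

(** Both cases, up or down by 1, in one equation free of truncated subtraction. *)
Lemma wt_dir d (x : cube d) (i : 'I_d) :
  (wt (x + dir i)%R + x i = wt x + ~~ x i)%N.
Proof.
rewrite /wt (bigD1 i)//= [in RHS](bigD1 i)//= !ffunE eqxx.
rewrite (eq_bigr (fun j => nat_of_bool (x j))) => [|j ji].
  by case: (x i) => /=; rewrite ?addn0 ?addn1 ?add0n ?add1n.
by rewrite !ffunE (negbTE ji); case: (x j).
Qed.

Lemma wt_dir_le d (x : cube d) (i : 'I_d) : (wt (x + dir i)%R <= (wt x).+1)%N.
Proof. by have := wt_dir x i; case: (x i) => /=; lia. Qed.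

Definition step (R : realType) d (f : cube d -> R) (x : cube d) : R :=
  d%:R^-1 * \sum_(i < d) f (x + dir i).

(* [walk n f x] is the expectation of [f] after [n] steps of the simple random
   walk on the cube started at [x]. *)
Definition walk (R : realType) d n (f : cube d -> R) : cube d -> R :=
  iter n (@step R d) f.

Lemma walkS (R : realType) d n (f : cube d -> R) x :
  walk n.+1 f x = d%:R^-1 * \sum_(i < d) walk n f (x + dir i).
Proof. by []. Qed.

Lemma walkD (R : realType) d m n (f : cube d -> R) :
  walk (m + n) f = walk m (walk n f).
Proof. exact: iterD. Qed.

Lemma step_cst (R : realType) d (a : R) : (0 < d)%N ->
  d%:R^-1 * \sum_(i < d) a = a.
Proof.
move=> d0; rewrite sumr_const card_ord -[a *+ d]mulr_natl mulKf//.
by rewrite pnatr_eq0 -lt0n.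
Qed.

Lemma walk_le (R : realType) d n (f g : cube d -> R) x :
  (forall y, f y <= g y) -> walk n f x <= walk n g x.
Proof.
move=> fg; elim: n x => [|n IH] x; first exact: fg.
by rewrite !walkS ler_wpM2l ?invr_ge0// ler_sum.
Qed.

Lemma walk_ge0 (R : realType) d n (f : cube d -> R) x :
  (forall y, 0 <= f y) -> 0 <= walk n f x.
Proof.
move=> f0; elim: n x => [|n IH] x; first exact: f0.
by rewrite walkS mulr_ge0 ?invr_ge0// sumr_ge0.
Qed.

Lemma walk_affine (R : realType) d n (a b : R) (f : cube d -> R) x : (0 < d)%N ->
  walk n (fun y => a + b * f y) x = a + b * walk n f x.
Proof.
move=> d0; elim: n x => [//|n IH] x; rewrite !walkS.
by rewrite (eq_bigr _ (fun i _ => IH _)) big_split/= mulrDr step_cst// -mulr_sumr mulrCA.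
Qed.

Lemma walk_ge (R : realType) d m n (p : R) (f : cube d -> R) x : (0 < d)%N ->
  (forall y, (wt y <= m)%N -> p <= f y) ->
  (wt x + n <= m)%N -> p <= walk n f x.
Proof.
move=> d0 pf; elim: n x => [|n IH] x xm; first by apply: pf; lia.
rewrite walkS -[leLHS](step_cst p d0) ler_wpM2l ?invr_ge0// ler_sum// => i _.
by apply: IH; have := wt_dir_le x i; lia.
Qed.

(** With w = [wt x], the weight falls with probability w / d and rises otherwise; a fall yields 4
    times the value of a rise, hence the factor 1 + 3 w / d. *)
Lemma step_half_wt (R : realType) d (x : cube d) : (0 < d)%N ->
  d%:R^-1 * \sum_(i < d) (1 / 2 : R) ^+ wt (x + dir i) =
  (1 / 2) ^+ (wt x).+1 * (1 + 3 * (wt x)%:R / d%:R).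
Proof.
move=> d0.
have E i : (1 / 2 : R) ^+ wt (x + dir i) =
    (1 / 2) ^+ (wt x).+1 * (1 + 3 * (x i)%:R).
  have := wt_dir x i; case: (x i) => /= H; last first.
    have -> : wt (x + dir i) = (wt x).+1 by lia.
    by rewrite mulr0 addr0 mulr1.
  have -> : wt x = (wt (x + dir i)).+1 by lia.
  by rewrite !exprS; lra.
rewrite (eq_bigr _ (fun i _ => E i)) -mulr_sumr mulrCA; congr (_ * _).
by rewrite big_split/= mulrDr step_cst// -mulr_sumr -natr_sum mulrC.
Qed.

(* A step decreases the weight of [x] with probability [wt x / d] only, so
   that [1 / 2 ^+ wt] shrinks by almost 2 at each of the first few steps. *)
Lemma walk_half_wt (R : realType) d N n (x : cube d) : (0 < d)%N ->
  (wt x + n <= N)%N ->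
  walk n (fun y => (1 / 2 : R) ^+ wt y) x <=
  (1 / 2) ^+ (wt x + n) * (1 + 3 * N%:R / d%:R) ^+ n.
Proof.
move=> d0; elim: n x => [|n IH] x xN; first by rewrite addn0 mulr1.
have B0 : 0 <= 1 + 3 * N%:R / d%:R :> R.
  by rewrite addr_ge0// divr_ge0// mulr_ge0.
rewrite walkS.
apply: (@le_trans _ _ (d%:R^-1 * \sum_(i < d) ((1 / 2) ^+ n *
    (1 + 3 * N%:R / d%:R) ^+ n * (1 / 2) ^+ wt (x + dir i)))).
  rewrite ler_wpM2l ?invr_ge0// ler_sum// => i _.
  apply: (le_trans (IH _ _)); first by have := wt_dir_le x i; lia.
  by rewrite exprD -mulrA mulrC.
rewrite -mulr_sumr mulrCA step_half_wt// addnS -addSn exprD [_ ^+ n.+1 in leRHS]exprSr.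
rewrite [leRHS](_ : _ = (1 / 2) ^+ n * (1 + 3 * N%:R / d%:R) ^+ n *
  ((1 / 2) ^+ (wt x).+1 * (1 + 3 * N%:R / d%:R))); last by ring.
rewrite ler_wpM2l ?mulr_ge0 ?exprn_ge0//.
rewrite ler_wpM2l ?exprn_ge0// lerD2l ler_wpM2r ?invr_ge0// ler_wpM2l//.
by rewrite ler_nat; lia.
Qed.

(** * Positive definite functions and log-convexity along the walk *)

Lemma walk_conv (R : realType) d n (f : cube d -> R) x :
  walk n f x = \sum_t walk n (fun y => (y == 0)%:R) t * f (x + t).
Proof.
elim: n f x => [|n IH] f x.
  rewrite (bigD1 (0 : cube d))//= eqxx mul1r addr0 big1 ?addr0// => t /negbTE t0.
  by rewrite /walk/= t0 mul0r.
rewrite /walk iterSr -/(walk n (step f)) IH /step.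
under eq_bigr do rewrite mulrCA mulr_sumr.
under [RHS]eq_bigr do rewrite -mulrA mulr_suml.
rewrite -!mulr_sumr; congr (_ * _).
rewrite exchange_big [RHS]exchange_big; apply: eq_bigr => i _.
(* The involution t -> t + [dir i] moves a step from [f] to the law of the walk. *)
rewrite (reindex (fun t : cube d => t + dir i)); last first.
  by exists (fun t : cube d => t + dir i) => t _; rewrite cube_addK.
by apply: eq_bigr => t _; rewrite -addrA cube_addK.
Qed.

(** The usual kernel g (s - t) on the group (Z/2)^d, where s - t = s + t. *)
Definition posdef (R : realType) d (g : cube d -> R) : Prop :=
  forall v : cube d -> R, 0 <= \sum_s \sum_t v s * v t * g (s + t).

Lemma discriminant_le (R : realType) (A X B : R) :
  (forall a b, 0 <= a ^+ 2 * A + 2 * (a * b * X) + b ^+ 2 * B) ->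
  X ^+ 2 <= A * B.
Proof.
move=> H.
have A0 : 0 <= A by have := H 1 0; lra.
have B0 : 0 <= B by have := H 0 1; lra.
(* The form is B (A B - X^2) at (B, -X) and A (A B - X^2) at (-X, A); if A = B = 0, the points (1,
   1) and (1, -1) force X = 0. *)
move: A0 B0; rewrite (le_eqVlt 0 A) (le_eqVlt 0 B) => /orP[/eqP A0|A0] /orP[/eqP B0|B0].
- have := H 1 1; have := H 1 (-1); rewrite -A0 -B0 => h1 h2.
  by have -> : X = 0 by lra; rewrite expr0n mulr0.
- have := H B (- X) => h; rewrite -subr_ge0 -(pmulr_rge0 _ B0); lra.
- have := H (- X) A => h; rewrite -subr_ge0 -(pmulr_rge0 _ A0); lra.
- have := H B (- X) => h; rewrite -subr_ge0 -(pmulr_rge0 _ B0); lra.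
Qed.

(** Cauchy-Schwarz for the form with kernel g (s + t): by translation invariance, [walk (m + n) g 0]
    is its value at the laws of m and of n steps. *)
Lemma walk_log_convex (R : realType) d (g : cube d -> R) i j : posdef g ->
  walk (i + j) g 0 ^+ 2 <= walk (i + i) g 0 * walk (j + j) g 0.
Proof.
move=> g0; set mu := fun n (t : cube d) => walk n (fun y => (y == 0)%:R : R) t.
have E m n : walk (m + n) g 0 = \sum_s \sum_t mu m s * mu n t * g (s + t).
  rewrite walkD walk_conv; apply: eq_bigr => s _.
  rewrite add0r [walk n g _]walk_conv mulr_sumr; apply: eq_bigr => t _.
  by rewrite mulrA.
have C : walk (j + i) g 0 = walk (i + j) g 0 by rewrite addnC.
apply: discriminant_le => a b.
rewrite [X in _ + X + _](_ : _ = a * b * walk (i + j) g 0 + b * a * walk (j + i) g 0);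
  last by rewrite C; ring.
have := g0 (fun s => a * mu i s + b * mu j s).
rewrite !E !mulr_sumr -!big_split/=.
congr (0 <= _); apply: eq_bigr => s _.
rewrite !mulr_sumr -!big_split/=.
by apply: eq_bigr => t _; ring.
Qed.

(** ln b is convex and vanishes at 0, so ln (b n) / n is nondecreasing. Powers replace logarithms
    since b may vanish. *)
Lemma log_convex_root_mono (R : realType) (b : nat -> R) :
  b 0%N = 1 -> (forall n, 0 <= b n) ->
  (forall n, b n.+1 ^+ 2 <= b n * b n.+2) ->
  forall j k, (j <= k)%N -> b j ^+ k <= b k ^+ j.
Proof.
move=> b1 b0 bc.
have S n : b n ^+ n.+1 <= b n.+1 ^+ n.
  elim: n => [|n IH]; first by rewrite b1 expr1n.
  have := b0 n.+1; rewrite le_eqVlt => /orP[/eqP <-|bn].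
    by rewrite exprS mul0r exprn_ge0.
  (* After multiplication by [b n.+1 ^+ n], log-convexity raised to the power n + 1 applies, then
     the induction hypothesis. *)
  rewrite -(ler_pM2l (exprn_gt0 n bn)) -exprD.
  rewrite (_ : (n + n.+2 = 2 * n.+1)%N); last by lia.
  rewrite exprM; apply: (@le_trans _ _ ((b n * b n.+2) ^+ n.+1)).
    by rewrite lerXn2r ?nnegrE ?mulr_ge0 ?exprn_ge0.
  by rewrite exprMn ler_wpM2r ?exprn_ge0.
move=> j; elim=> [|k IH]; first by rewrite leqn0 => /eqP ->; rewrite b1.
rewrite leq_eqVlt => /orP[/eqP -> //|]; rewrite ltnS => jk.
case: k IH jk => [_|k IH jk].
  by rewrite leqn0 => /eqP ->; rewrite b1 expr1n.
rewrite -(ler_pXn2r (n := k.+1)) ?nnegrE ?exprn_ge0// -exprM mulnC exprM.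
apply: (@le_trans _ _ ((b k.+1 ^+ j) ^+ k.+2)).
  by rewrite lerXn2r ?nnegrE ?exprn_ge0// IH.
rewrite -exprM mulnC exprM -[leRHS]exprM mulnC [leRHS]exprM.
by rewrite lerXn2r ?nnegrE ?exprn_ge0.
Qed.

(** * Collision probabilities *)

Lemma measurable_collision (X : Type) (U : pointedType) (x y : X) :
  measurable (collision U x y : set (g_sigma_algebraType (@collisions X U))).
Proof. by apply: sub_gen_smallest; exists x, y. Qed.

Lemma collision_fineK (R : realType) (X : Type) (U : pointedType)
    (H : hash_family R X U) (x y : X) :
  (fine (H (collision U x y)))%:E = H (collision U x y).
Proof. by rewrite fineK// fin_num_measure//; exact: measurable_collision. Qed.

(** The form splits into one square for each fiber of [r]. *)
Lemma same_fiber_psd (R : realType) (V W : finType) (r : V -> W) (v : V -> R) :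
  0 <= \sum_a \sum_b v a * v b * (r a == r b)%:R.
Proof.
rewrite (partition_big r predT)//=.
apply: sumr_ge0 => c _.
rewrite (_ : \sum_(a | r a == c) _ = (\sum_(a | r a == c) v a) ^+ 2) ?sqr_ge0//.
rewrite expr2 mulr_suml; apply: eq_bigr => a /eqP ->.
rewrite mulr_sumr [RHS]big_mkcond; apply: eq_bigr => b _.
by rewrite eq_sym; case: eqP; rewrite ?mulr1 ?mulr0.
Qed.

(** For a fixed h the collision matrix is that of an equivalence relation, hence positive
    semidefinite; integration over h preserves this. *)
Lemma collision_psd (R : realType) (X : Type) (U : pointedType)
    (H : hash_family R X U) (V : finType) (phi : V -> X) (v : V -> R) :
  0 <= \sum_a \sum_b v a * v b * fine (H (collision U (phi a) (phi b))).
Proof.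
pose F (ab : V * V) (h : g_sigma_algebraType (@collisions X U)) : \bar R :=
  ((v ab.1 * v ab.2)%:E * (\1_(collision U (phi ab.1) (phi ab.2)) h)%:E)%E.
have mC ab : measurable (collision U (phi ab.1) (phi ab.2) :
    set (g_sigma_algebraType (@collisions X U))).
  exact: measurable_collision.
have iF ab : H.-integrable setT (F ab).
  by apply: integrableZl => //; apply: integrable_indic; exact: mC.
have -> : \sum_a \sum_b v a * v b * fine (H (collision U (phi a) (phi b))) =
    fine (\int[H]_h (\sum_(ab : V * V) F ab h)%E).
  rewrite pair_bigA/= integral_sum//.
  rewrite -[LHS]/(fine _%:E) -sumEFin; congr fine.
  apply: eq_bigr => -[a b] _ /=; rewrite /F integralZl//=; last first.
    by apply: integrable_indic; exact: (mC (a, b)).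
  rewrite integral_indic//; last exact: (mC (a, b)).
  by rewrite setIT EFinM collision_fineK.
apply: fine_ge0; apply: integral_ge0 => h _.
(* [U] may be infinite, so [h] is replaced by a choice of representatives in the finite [V]. The
   default of [odflt] never occurs, as a itself qualifies. *)
pose r a := odflt a [pick c | `[< h (phi c) = h (phi a) >]].
have hr a : h (phi (r a)) = h (phi a).
  by rewrite /r; case: pickP => [c /asboolP|].
have rE a b : (r a == r b) = `[< h (phi a) = h (phi b) >].
  apply/eqP/asboolP => ab; first by rewrite -hr ab hr.
  rewrite /r (@eq_pick _ _ (fun c => `[< h (phi c) = h (phi b) >])); last first.
    by move=> c; rewrite ab.
  by case: pickP => [//|/(_ b)/asboolP].
have -> : (\sum_(ab : V * V) F ab h)%E =
    (\sum_a \sum_b v a * v b * (r a == r b)%:R)%:E.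
  rewrite pair_bigA/= -sumEFin; apply: eq_bigr => -[a b] _.
  rewrite /F/= -EFinM; congr (_ * _)%:E.
  rewrite indicE; congr ((nat_of_bool _)%:R); rewrite rE.
  by apply/idP/asboolP; rewrite inE.
by rewrite lee_fin same_fiber_psd.
Qed.

Definition avg_collision (R : realType) (X : Type) (U : pointedType)
    (H : hash_family R X U) d (phi : cube d -> X) (t : cube d) : R :=
  #|{: cube d}|%:R^-1 * \sum_z fine (H (collision U (phi z) (phi (z + t)))).

Lemma cube_avg_cst (R : realType) d (a : R) :
  #|{: cube d}|%:R^-1 * \sum_(z : cube d) a = a.
Proof.
rewrite sumr_const -[a *+ _]mulr_natl mulKf// pnatr_eq0 -lt0n.
by apply/card_gt0P; exists (0 : cube d).
Qed.

(** Replacing z by z + s turns the pair (z, z + s + t) into (z + s, z + t), which for each z gives a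
    collision matrix indexed by s and t. *)
Lemma avg_collision_posdef (R : realType) (X : Type) (U : pointedType)
    (H : hash_family R X U) d (phi : cube d -> X) :
  posdef (avg_collision H phi).
Proof.
move=> v.
under eq_bigr do under eq_bigr do rewrite mulrCA mulr_sumr.
under eq_bigr do rewrite -mulr_sumr.
rewrite -mulr_sumr mulr_ge0 ?invr_ge0//.
have -> : \sum_(s : cube d) \sum_(t : cube d) \sum_(z : cube d)
      v s * v t * fine (H (collision U (phi z) (phi (z + (s + t))))) =
    \sum_(z : cube d) \sum_(s : cube d) \sum_(t : cube d)
      v s * v t * fine (H (collision U (phi (z + s)) (phi (z + t)))).
  rewrite [RHS]exchange_big; apply: eq_bigr => s _.
  rewrite [RHS]exchange_big; apply: eq_bigr => t _.
  rewrite (reindex (fun z : cube d => z + s)); last first.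
    by exists (fun z : cube d => z + s) => z _; rewrite cube_addK.
  by apply: eq_bigr => z _; rewrite addrA cube_addK.
by apply: sumr_ge0 => z _; exact: collision_psd.
Qed.

Lemma avg_collision_ge (R : realType) (X : Type) (U : pointedType)
    (H : hash_family R X U) d (phi : cube d -> X) (t : cube d) (p : R) :
  (forall z, (p%:E <= H (collision U (phi z) (phi (z + t)%R)))%E) ->
  p <= avg_collision H phi t.
Proof.
move=> pH; rewrite -[leLHS](cube_avg_cst d) ler_wpM2l ?invr_ge0// ler_sum// => z _.
by rewrite -lee_fin collision_fineK.
Qed.

Lemma avg_collision_le (R : realType) (X : Type) (U : pointedType)
    (H : hash_family R X U) d (phi : cube d -> X) (t : cube d) (q : R) :
  (forall z, (H (collision U (phi z) (phi (z + t)%R)) <= q%:E)%E) ->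
  avg_collision H phi t <= q.
Proof.
move=> pH; rewrite -[leRHS](cube_avg_cst d) ler_wpM2l ?invr_ge0// ler_sum// => z _.
by rewrite -lee_fin collision_fineK.
Qed.

Lemma collision_refl (X U : Type) (x : X) : collision U x x = setT.
Proof. by apply/seteqP; split. Qed.

Lemma avg_collision0 (R : realType) (X : Type) (U : pointedType)
    (H : hash_family R X U) d (phi : cube d -> X) : avg_collision H phi 0 = 1.
Proof.
apply/eqP; rewrite eq_le; apply/andP; split.
  by apply: avg_collision_le => z; rewrite addr0 collision_refl probability_setT.
by apply: avg_collision_ge => z; rewrite addr0 collision_refl probability_setT.
Qed.

(** * Scaled cubes in l_s^d and the comparison of near and far collisions *)

Definition scaled_cube (R : realType) d (sigma : R) (x : cube d) : 'rV[R]_d :=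
  \row_i (sigma * (x i)%:R).

Lemma ell_dist_scaled_cube (R : realType) d (s sigma : R) (z t : cube d) :
  0 < s -> 0 <= sigma ->
  ell_dist s (scaled_cube sigma z) (scaled_cube sigma (z + t)) =
  sigma * (wt t)%:R `^ (1 / s).
Proof.
move=> s0 sigma0; rewrite /ell_dist.
have E i : `|scaled_cube sigma z 0 i - scaled_cube sigma (z + t) 0 i| `^ s =
    sigma `^ s * (t i)%:R.
  rewrite !mxE ffunE -mulrBr normrM (ger0_norm sigma0) powRM//; congr (_ * _).
  case: (z i); case: (t i);
    rewrite /= ?subrr ?subr0 ?sub0r ?normrN ?normr0 ?normr1 ?powR1 ?powR0//;
    by rewrite gt_eqF.
rewrite (eq_bigr _ (fun i _ => E i)) -mulr_sumr -natr_sum.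
rewrite powRM ?powR_ge0// -powRrM div1r mulfV ?gt_eqF// powRr1//.
Qed.

(** The factor of 1 - q bounds the probability that 2k steps from 0 end at weight below [X], by
    Markov's inequality for 2^(-wt). *)
Lemma near_le_far (R : realType) d (g : cube d -> R) (p q X : R) (j k : nat) :
  (0 < d)%N -> (j <= k)%N -> 0 <= p -> 0 <= q -> q <= 1 ->
  posdef g -> g 0 = 1 -> (forall t, 0 <= g t <= 1) ->
  (forall t, (wt t <= j.*2)%N -> p <= g t) ->
  (forall t, X <= (wt t)%:R -> g t <= q) ->
  p ^+ k <=
  (q + (1 - q) * (2 `^ X *
    ((1 / 2) ^+ k.*2 * (1 + 3 * (k.*2)%:R / d%:R) ^+ k.*2))) ^+ j.
Proof.
move=> d0 jk p0 q0 q1 gpos g0 g01 gp gq.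
have w0 n : 0 <= walk n g 0 by apply: walk_ge0 => y; have /andP[] := g01 y.
(* Even times only: Cauchy-Schwarz bounds time n + (n + 2) by the times 2n and 2(n + 2). *)
pose b n := walk n.*2 g 0.
have := @log_convex_root_mono R b _ _ _ j k jk.
have -> : (b 0%N = 1) by rewrite /b /walk.
move=> /(_ erefl (fun n => w0 _)) bjk.
apply: (@le_trans _ _ (b j ^+ k)).
  by rewrite lerXn2r ?nnegrE ?w0//; apply: (walk_ge d0 gp); rewrite wt0.
apply: le_trans (bjk _) _ => [n|].
  rewrite /b (_ : n.+1.*2 = (n + n.+2)%N); last by lia.
  by rewrite -!addnn walk_log_convex.
have q1' : 0 <= 1 - q by rewrite subr_ge0.
rewrite lerXn2r ?nnegrE//.
- exact: w0.
- by rewrite addr_ge0// mulr_ge0// mulr_ge0 ?powR_ge0// mulr_ge0 ?exprn_ge0//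
    addr_ge0// divr_ge0// mulr_ge0.
(* From weight X on, the term q suffices; below X, 2^(X - wt y) >= 1 lifts the majorant to at least
   1. *)
apply: (@le_trans _ _ (walk k.*2 (fun y => q + ((1 - q) * 2 `^ X) * (1 / 2) ^+ wt y) 0)).
  apply: walk_le => y; have [Xy|yX] := leP X (wt y)%:R.
    apply: le_trans (gq y Xy) _.
    by rewrite lerDl mulr_ge0 ?exprn_ge0// mulr_ge0// powR_ge0.
  have /andP[_ /le_trans] := g01 y; apply.
  rewrite -lerBlDl -mulrA ler_peMr//.
  rewrite div1r exprVn ler_pdivlMr ?exprn_gt0// mul1r -powR_mulrn//.
  by apply: ler_powR; [lra|exact: ltW].
rewrite walk_affine// lerD2l -[leLHS]mulrA ler_wpM2l// ler_wpM2l ?powR_ge0//.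
have := @walk_half_wt R d k.*2 k.*2 0 d0.
by rewrite wt0 add0n; apply.
Qed.

Lemma sensitive_near_le_far (R : realType) (s c r p q : R) (d j k : nat)
    (U : pointedType) (H : hash_family R 'rV[R]_d U) :
  0 < s -> 0 < c -> 0 < r -> (0 < d)%N -> (0 < j)%N -> (j <= k)%N ->
  0 <= q -> q <= 1 ->
  sensitive (@ell_dist R s d) r (c * r) p q H ->
  p ^+ k <=
  (q + (1 - q) * (2 `^ (c `^ s * (j.*2)%:R) *
    ((1 / 2) ^+ k.*2 * (1 + 3 * (k.*2)%:R / d%:R) ^+ k.*2))) ^+ j.
Proof.
move=> s0 c0 r0 d0 j0 jk q0 q1 [qp Hs].
have is0 : 0 <= 1 / s by rewrite divr_ge0// ltW.
have m0 : 0 < (j.*2)%:R `^ (1 / s) :> R by rewrite powR_gt0// ltr0n double_gt0.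
(* At this scale Hamming distance 2j becomes r, and Hamming distance c^s 2j becomes c r. *)
pose sigma := r / (j.*2)%:R `^ (1 / s).
have sigma0 : 0 < sigma by rewrite divr_gt0.
pose g := avg_collision H (@scaled_cube R d sigma).
apply: (@near_le_far R d g) => //.
- by rewrite (le_trans q0)// ltW.
- exact: avg_collision_posdef.
- exact: avg_collision0.
- move=> t; apply/andP; split.
    by apply: avg_collision_ge => z; rewrite measure_ge0.
  by apply: avg_collision_le => z; rewrite probability_le1//; exact: measurable_collision.
- move=> t tj; apply: avg_collision_ge => z.
  apply: (Hs _ _).1; rewrite ell_dist_scaled_cube// ?(ltW sigma0)//.
  rewrite /sigma mulrAC ler_pdivrMr// ler_wpM2l ?(ltW r0)//.
  by rewrite ge0_ler_powR// ?nnegrE// ler_nat.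
- move=> t tj; apply: avg_collision_le => z.
  apply: (Hs _ _).2; rewrite ell_dist_scaled_cube// ?(ltW sigma0)//.
  rewrite /sigma mulrAC ler_pdivlMr// mulrC mulrA [leLHS]mulrC ler_wpM2l ?(ltW r0)//.
  rewrite (_ : _ * c = (c `^ s * (j.*2)%:R) `^ (1 / s)).
    by rewrite ge0_ler_powR// ?nnegrE ?mulr_ge0 ?powR_ge0.
  rewrite powRM ?powR_ge0// -powRrM div1r mulfV ?gt_eqF// powRr1 ?(ltW c0)//.
  by rewrite mulrC.
Qed.

Lemma sensitive_le1 (R : realType) (X : Type) (U : pointedType)
    (dist : X -> X -> R) (r r' p q : R) (H : hash_family R X U) (x : X) :
  dist x x <= r -> sensitive dist r r' p q H -> p <= 1.
Proof.
move=> xr [_ /(_ x x)[/(_ xr)]].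
by rewrite collision_refl probability_setT lee_fin.
Qed.

(** * Choice of the numbers of steps *)

(** ln (q + (1 - q) delta) <= ln q + (1 - q) delta / q, and 1 - q <= - ln q makes the error at most
    a fraction delta / q of ln (1 / q), even for q near 1. *)
Lemma rho_ge (R : realType) (p q delta : R) (j k : nat) :
  0 < p -> 0 < q -> q < 1 -> 0 <= delta -> (0 < k)%N ->
  p ^+ k <= (q + (1 - q) * delta) ^+ j ->
  j%:R / k%:R * (1 - delta / q) <= rho p q.
Proof.
move=> p0 q0 q1 delta0 k0 pk.
have lq : 1 - q <= - ln q by have := @le_ln1Dx R (q - 1); rewrite subrKC; lra.
have lq0 : 0 < - ln q by lra.
have x0 : 0 <= (1 - q) * (delta / q) by rewrite mulr_ge0 ?divr_ge0//; lra.
have E : q + (1 - q) * delta = q * (1 + (1 - q) * (delta / q)).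
  by field; rewrite gt_eqF.
have lx : ln (q + (1 - q) * delta) <= ln q + - ln q * (delta / q).
  rewrite E lnM ?posrE//; last by lra.
  rewrite lerD2l; apply: le_trans (le_ln1Dx _) _; first by lra.
  by rewrite ler_wpM2r// divr_ge0// ltW.
have r0 : 0 < q + (1 - q) * delta by rewrite E mulr_gt0//; lra.
have kp : k%:R * ln p <= j%:R * ln (q + (1 - q) * delta).
  by rewrite !mulr_natl -!lnXn// ler_ln// posrE exprn_gt0.
rewrite /rho !div1r !lnV ?posrE// ler_pdivlMr//.
rewrite [leLHS](_ : _ = - (j%:R * (ln q + - ln q * (delta / q))) / k%:R); last by ring.
rewrite ler_pdivrMr ?ltr0n// [leRHS]mulNr lerN2 mulrC; apply: le_trans kp _.
by rewrite ler_wpM2l.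
Qed.

Lemma ln2_ge_half (R : realType) : 1 / 2 <= ln 2 :> R.
Proof.
have := @le_ln1Dx R (- (1 / 2)); rewrite (_ : 1 + _ = 2^-1); last by lra.
by rewrite lnV ?posrE//; lra.
Qed.

(* Among [2k] steps, the expected number of those undoing an earlier one is at most
   [(2k) ^ 2 / D], a small fraction of the number [8 * eta * k] by which
   [C * 2j] falls short of [2k]. *)
Lemma far_tail_le (R : realType) (eta C D : R) (j k : nat) :
  0 < eta -> 0 < D -> k%:R <= eta * D / 8 ->
  C * j%:R <= k%:R * (1 - 4 * eta) ->
  2 `^ (C * (j.*2)%:R) * ((1 / 2) ^+ k.*2 * (1 + 3 * (k.*2)%:R / D) ^+ k.*2)
  <= expR (- (2 * (k%:R * eta))).
Proof.
move=> e0 D0 kD jk.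
have l2 := ln2_ge_half R.
have -> : (1 / 2) ^+ k.*2 = expR (- (k.*2%:R * ln 2)) :> R.
  by rewrite expRN expRM_natl lnK ?posrE// div1r exprVn.
have h : (1 + 3 * (k.*2)%:R / D) ^+ k.*2 <= expR (k.*2%:R * (3 * (k.*2)%:R / D)).
  rewrite expRM_natl; apply: lerXn2r; rewrite ?nnegrE ?expR_ge0//.
    by rewrite addr_ge0// divr_ge0 ?(ltW D0)// mulr_ge0.
  exact: expR_ge1Dx.
rewrite /powR gt_eqF//.
apply: le_trans (_ : expR (C * j.*2%:R * ln 2) * (expR (- (k.*2%:R * ln 2)) *
   expR (k.*2%:R * (3 * (k.*2)%:R / D))) <= _).
  by do 2!rewrite ler_wpM2l ?expR_ge0//.
rewrite -!expRD ler_expR -!mul2n !natrM.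
have ke : 0 <= k%:R * eta by rewrite mulr_ge0// ltW.
have a : k%:R * k%:R / D <= k%:R * eta / 8.
  rewrite -!mulrA ler_wpM2l// ler_pdivrMr//; lra.
have b : 2 * (C * j%:R - k%:R) * ln 2 <= - (8 * (k%:R * eta)) * (1 / 2).
  apply: (@le_trans _ _ (- (8 * (k%:R * eta)) * ln 2)).
    by rewrite ler_wpM2r//; lra.
  by rewrite ler_wnM2l//; lra.
(* Of the two final terms, the first is at most - 4 k eta and the second at most (3/2) k eta. *)
have -> : C * (2 * j%:R) * ln 2 +
    (- (2 * k%:R * ln 2) + 2 * k%:R * (3 * (2 * k%:R) / D)) =
    2 * (C * j%:R - k%:R) * ln 2 + 12 * (k%:R * k%:R / D) by ring.
lra.
Qed.

(** Both numbers are the largest that [far_tail_le] allows: k is eta D / 8 and j is k (1 - 4 eta) /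
    C, rounded down. As k eta >= 1, rounding j costs at most eta in j / k. *)
Lemma walk_lengths (R : realType) (eta C q D : R) :
  0 < eta -> 1 < C -> 16 * eta < 1 / C -> 0 < q -> q < 1 -> 0 < D ->
  2 * ln (2 / q) <= eta ^+ 3 * D ->
  exists j k : nat, [/\ (0 < j)%N, (j <= k)%N,
    1 / C - 8 * eta <= j%:R / k%:R &
    2 `^ (C * (j.*2)%:R) * ((1 / 2) ^+ k.*2 * (1 + 3 * (k.*2)%:R / D) ^+ k.*2)
    <= q * (8 * eta)].
Proof.
move=> e0 C1 eC q0 q1 D0 big.
have C0 : 0 < C by lra.
have iC0 : 0 < 1 / C by rewrite divr_gt0.
have iC1 : 1 / C < 1 by rewrite ltr_pdivrMr// mul1r.
(* [2 / q] in place of [1 / q] keeps the logarithm away from 0 as q tends to 1. *)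
have L0 : 1 / 2 <= ln (2 / q).
  apply: le_trans (ln2_ge_half R) _.
  by rewrite ler_ln ?posrE ?divr_gt0// ler_pdivlMr//; lra.
have qE : q / 2 = expR (- ln (2 / q)).
  by rewrite expRN lnK ?posrE ?divr_gt0// invf_div.
move: (ln (2 / q)) L0 big qE => L L0 big qE.
have e2D : 2 * (L / eta) <= eta ^+ 2 * D.
  by rewrite mulrA ler_pdivrMr// mulrAC -exprSr.
have Le : 8 <= L / eta by rewrite ler_pdivlMr//; lra.
have e1D : 16 * (eta ^+ 2 * D) <= eta * D.
  rewrite (_ : 16 * _ = 16 * eta * (eta * D)); last by ring.
  by rewrite ler_piMl ?mulr_ge0 ?ltW//; lra.
have kge0 : 0 <= eta * D / 8 by rewrite divr_ge0// mulr_ge0// ltW.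
pose k := Num.truncn (eta * D / 8).
have /andP[kl kr] := truncn_itv kge0; rewrite -/k -(natr1 k) in kl kr.
(* Since eta D >= 16, rounding down loses at most half of eta D / 8. *)
have keD : eta ^+ 2 * D / 16 <= k%:R * eta.
  rewrite (_ : _ / 16 = eta * D / 16 * eta); last by ring.
  rewrite ler_wpM2r ?(ltW e0)//; lra.
have ke : L / eta / 8 <= k%:R * eta by lra.
have k0 : 0 < k%:R :> R by rewrite -(pmulr_lgt0 _ e0); lra.
clearbody k; clear big e2D e1D keD kge0 kr.
have m0 : 0 < k%:R * (1 - 4 * eta) by rewrite mulr_gt0//; lra.
have Y0 : 0 <= k%:R * (1 - 4 * eta) * (1 / C) by rewrite mulr_ge0// ltW.
pose j := Num.truncn (k%:R * (1 - 4 * eta) * (1 / C)).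
have /andP[jl jr] := truncn_itv Y0; rewrite -/j -(natr1 j) in jl jr.
exists j, k; split.
- rewrite truncn_gt0.
  apply: (@le_trans _ _ (k%:R * (1 - 4 * eta) * (16 * eta))).
    have : k%:R * eta * (3 / 4) <= k%:R * eta * (1 - 4 * eta).
      by apply: ler_wpM2l; lra.
    lra.
  by rewrite ler_wpM2l ?ltW.
- rewrite -(ler_nat R); apply: (le_trans jl).
  apply: (@le_trans _ _ (k%:R * (1 - 4 * eta))); first by rewrite ler_piMr ?ltW.
  by rewrite ler_piMr ?(ltW k0)//; lra.
- rewrite ler_pdivlMr//.
  have : k%:R * eta * (1 / C) <= k%:R * eta by rewrite ler_piMr ?ltW//; lra.
  lra.
- apply: le_trans (far_tail_le e0 D0 kl _) _.
    by rewrite mulrC -ler_pdivlMr//; move: jl; rewrite div1r.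
  have e16 : 0 < 16 * eta by rewrite mulr_gt0.
  have ee : expR (- (16 * eta)^-1) <= 16 * eta.
    rewrite expRN -[leRHS]invrK lef_pV2 ?posrE ?expR_gt0 ?invr_gt0//.
    by apply: le_trans (expR_ge1Dx _); rewrite lerDr.
  have -> : q * (8 * eta) = expR (- L) * (16 * eta) by rewrite -qE; lra.
  apply: (@le_trans _ _ (expR (- L) * expR (- (16 * eta)^-1))); last first.
    by rewrite ler_wpM2l ?expR_ge0.
  (* It remains that L + 1 / (16 eta) <= 2 k eta: the left side is at most 3 L / (16 eta), as L >=
     1/2 and 16 eta <= 1, and the right side is at least 4 L / (16 eta). *)
  rewrite -expRD ler_expR -opprD lerN2.
  have LE : L / eta = 16 * (L / (16 * eta)) by field; rewrite gt_eqF.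
  have ie : 1 <= (16 * eta)^-1 by rewrite invf_ge1// ltW// (lt_trans eC).
  have : (16 * eta)^-1 * (1 / 2) <= (16 * eta)^-1 * L by rewrite ler_wpM2l// invr_ge0 ltW.
  have : L <= L / (16 * eta) by rewrite ler_peMr//; lra.
  lra.
Qed.

(** * The bound on rho and its constant *)

Theorem corollary3p2 (R : realType) :
  exists K : R, 0 < K /\
  forall (s : R) (d : nat) (c q : R),
    0 < s -> 1 < c -> 0 < q -> q < 1 ->
    2 <= d%:R / ln (2 / q) ->
    exists tau : R, [/\ 0 < tau, tau < 1 &
      forall (U : pointedType) (p : R) (H : hash_family R 'rV[R]_d U),
        countable [set: U] ->
        sensitive (@ell_dist R s d) (tau * d%:R) (c * (tau * d%:R)) p q H ->
        1 / c `^ s -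
          (K * (ln (2 / q) / d%:R) * ln (d%:R / ln (2 / q))) `^ (1 / 3)
        <= rho p q].
Proof.
(* The subtracted term is 16 eta with eta^3 = [x]; the 4 in [x] gives eta^3 d >= 2 ln (2 / q),
   because ln (d / ln (2 / q)) >= ln 2 >= 1/2. *)
exists (16 ^+ 3 * 4); split; first by rewrite mulr_gt0// exprn_gt0.
move=> s d c q s0 c1 q0 q1 dL.
(* Any value in (0, 1) would do: the scale of the cube absorbs the threshold. *)
exists (1 / 2); split; [lra|lra|] => U p H _ Hs.
have qp := Hs.1.
have L0 : 0 < ln (2 / q).
  by rewrite ln_gt0// ltr_pdivlMr//; lra.
have D0 : 0 < d%:R :> R.
  by move: dL; rewrite ler_pdivlMr// => dL; apply: lt_le_trans dL; rewrite mulr_gt0.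
have p0 : 0 < p by exact: lt_trans qp.
have p1 : p <= 1.
  apply: (sensitive_le1 (x := 0) _ Hs).
  rewrite /ell_dist big1 => [|i _]; last by rewrite subrr normr0 powR0// gt_eqF.
  by rewrite powR0 ?mulr_ge0 ?divr_ge0// div1r invr_eq0 gt_eqF.
set x := 4 * (ln (2 / q) / d%:R) * ln (d%:R / ln (2 / q)).
have xL : 2 * (ln (2 / q) / d%:R) <= x.
  have : ln (2 / q) / d%:R * (1 / 2) <= ln (2 / q) / d%:R * ln (d%:R / ln (2 / q)).
    rewrite ler_wpM2l ?divr_ge0 ?(ltW L0) ?(ltW D0)//.
    by apply: le_trans (ln2_ge_half R) _; rewrite ler_ln ?posrE ?divr_gt0.
  by rewrite /x; lra.
have x0 : 0 < x by apply: lt_le_trans xL; rewrite mulr_gt0// divr_gt0.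
rewrite (_ : 16 ^+ 3 * 4 * _ * _ = 16 ^+ 3 * x); last by rewrite /x !mulrA.
rewrite powRM ?exprn_ge0 ?(ltW x0)//.
have -> : (16 ^+ 3) `^ (1 / 3) = 16 :> R.
  by rewrite -powR_mulrn// -powRrM div1r divff// powRr1.
have e0 : 0 < x `^ (1 / 3) by rewrite powR_gt0.
have e3 : (x `^ (1 / 3)) ^+ 3 = x.
  by rewrite -powR_mulrn ?powR_ge0// -powRrM div1r mulVf// powRr1// ltW.
move: (x `^ (1 / 3)) e0 e3 => eta e0 e3.
have C1 : 1 < c `^ s.
  rewrite (_ : 1 = 1 `^ s); last by rewrite powR1.
  by rewrite gt0_ltr_powR ?nnegrE//; lra.
have rho0 : 0 <= rho p q.
  by rewrite divr_ge0// ln_ge0// ler_pdivlMr// mul1r// ltW.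
(* If 1 / c^s <= 16 eta, the claimed bound is at most 0, while rho >= 0 since p <= 1. *)
have [Ce|eC] := leP (1 / c `^ s) (16 * eta).
  by apply: le_trans rho0; rewrite subr_le0.
have [|j [k [j0 jk jkC del]]] := @walk_lengths R eta (c `^ s) q d%:R e0 C1 eC q0 q1 D0.
  by rewrite e3 -ler_pdivrMr// -mulrA.
have c0 : 0 < c by lra.
have r0 : 0 < 1 / 2 * d%:R :> R by rewrite mulr_gt0.
have d0 : (0 < d)%N by rewrite -(ltr0n R).
have k0 : (0 < k)%N by exact: leq_trans jk.
have := sensitive_near_le_far s0 c0 r0 d0 j0 jk (ltW q0) (ltW q1) Hs.
move: del; set delta := 2 `^ _ * _ => del.
have delta0 : 0 <= delta.
  by rewrite mulr_ge0 ?powR_ge0// mulr_ge0 ?exprn_ge0// addr_ge0// divr_ge0// mulr_ge0.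
move=> /(rho_ge p0 q0 q1 delta0 k0); apply: le_trans.
have dq : delta / q <= 8 * eta by rewrite ler_pdivrMr// mulrC.
have jk0 : 0 <= j%:R / k%:R :> R by rewrite divr_ge0.
(* Of the loss 16 eta, half comes from j / k and half from delta / q, as j / k <= 1. *)
have : j%:R / k%:R * (delta / q) <= j%:R / k%:R * (8 * eta) by rewrite ler_wpM2l.
have : j%:R / k%:R * (8 * eta) <= 8 * eta.
  rewrite ler_piMl// ?mulr_ge0 ?(ltW e0)//.
  by rewrite ler_pdivrMr ?ltr0n// mul1r ler_nat.
lra.
Qed.
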